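(* Let $R$ be a nonzero commutative ring with identity and let $n\geq 1$. Let $\mathsf{T}(R^\times)$ denote the torsion subgroup of the unit group $R^\times$. Then the set $\mathsf{T}_{\bullet}(T_n(R))$ of generalized torsion elements of $T_n(R)$ is \[ \mathsf{T}_{\bullet}(T_n(R)) = UT_n(R)\rtimes D_n(\mathsf{T}(R^\times)). \] In particular: (1) $\mathsf{T}_{\bullet}(T_n(R))$ is a characteristic subgroup of $T_n(R)$; (2) $UT_n(R)\subseteq \mathsf{T}_{\bullet}(T_n(R))$; and (3) $\mathsf{T}_{\bullet}(T_n(R))=T_n(R)$ if and only if $R^\times$ is a torsion group.
   Context: For a group $G$ and $g,x\in G$ write $g^x=x^{-1}gx$. An element $g\in G$ is generalized torsion if there exist $k\geq 1$ and $x_1,\dots,x_k\in G$ with $g^{x_1}g^{x_2}\cdots g^{x_k}=1$; $\mathsf{T}_{\bullet}(G)$ denotes the set of all generalized torsion elements of $G$. For a commutative ring $R$ with unit group $R^\times$, $T_n(R)$ is the group of invertible upper triangular $n\times n$ matrices over $R$ (upper triangular with diagonal entries in $R^\times$), $UT_n(R)$ is the subgroup of those with all diagonal entries equal to $1$, and for a subgroup $S\leq R^\times$, $D_n(S)$ is the group of diagonal matrices with all diagonal entries in $S$. One has $T_n(R)=UT_n(R)\rtimes D_n(R^\times)$, and $UT_n(R)\rtimes D_n(S)$ denotes the (internal) subgroup of upper triangular matrices over $R$ with all diagonal entries in $S$. *)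

(* Defs.v *)
From HB Require Import structures.
From mathcomp Require Import all_boot all_order all_algebra.
From mathcomp Require Import boolp classical_sets.

Set Implicit Arguments.
Unset Strict Implicit.
Unset Printing Implicit Defensive.

Import GRing.Theory.

Local Open Scope group_scope.
Local Open Scope classical_set_scope.

Section AbstractGroups.

Variable G : groupType.

Definition generalized_torsion : set G :=
  [set g | exists (k : nat) (x : 'I_k -> G),
     (0 < k)%N /\ \prod_(i < k) g ^ x i = 1].

Definition torsion : set G :=
  [set g | exists k : nat, (0 < k)%N /\ g ^+ k = 1].

Definition torsion_group : Prop := forall g : G, torsion g.

Definition subgroup (H : set G) : Prop :=
  [/\ H 1, (forall x y, H x -> H y -> H (x * y))
     & (forall x, H x -> H x^-1)].

Definition characteristic_subgroup (H : set G) : Prop :=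
  subgroup H /\
  (forall phi : {multiplicative G -> G}, bijective phi -> phi @` H = H).

Definition internal_sdprod (N H K : set G) : Prop :=
  [/\ subgroup N, subgroup H,
      (forall x h, N x -> H h -> N (x ^ h)),
      N `&` H = [set 1]
    & K = [set x * h | x in N & h in H]].

End AbstractGroups.

Arguments generalized_torsion : clear implicits.
Arguments torsion : clear implicits.
Arguments torsion_group : clear implicits.

Section Units.

(* comUnitRingType includes 1 != 0, so [R] is nonzero. *)
Variable R : comUnitRingType.

Record units := Units {
  units_val :> R;
  units_valP : units_val \is a GRing.unit }.

HB.instance Definition _ := [isSub for units_val].
HB.instance Definition _ := [Choice of units by <:].

Definition units_one := Units (unitr1 R).

Definition units_mul (u v : units) : units :=
  insubd units_one (val u * val v)%R.

Definition units_inv (u : units) : units := insubd units_one (val u)^-1%R.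

Lemma units_mulE u v : val (units_mul u v) = (val u * val v)%R.
Proof. by rewrite val_insubd unitrMl ?(valP u) ?(valP v). Qed.

Lemma units_invE u : val (units_inv u) = (val u)^-1%R.
Proof. by rewrite val_insubd unitrV (valP u). Qed.

Lemma units_mulA : associative units_mul.
Proof. by move=> u v w; apply: val_inj; rewrite !units_mulE mulrA. Qed.

Lemma units_mul1 : left_id units_one units_mul.
Proof. by move=> u; apply: val_inj; rewrite units_mulE mul1r. Qed.

Lemma units_mulr1 : right_id units_one units_mul.
Proof. by move=> u; apply: val_inj; rewrite units_mulE mulr1. Qed.

Lemma units_mulV : left_inverse units_one units_inv units_mul.
Proof.
by move=> u; apply: val_inj; rewrite units_mulE units_invE mulVr ?(valP u).
Qed.

Lemma units_mulrV : right_inverse units_one units_inv units_mul.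
Proof.
by move=> u; apply: val_inj; rewrite units_mulE units_invE mulrV ?(valP u).
Qed.

HB.instance Definition _ :=
  isGroup.Build units units_mulA units_mul1 units_mulr1 units_mulV units_mulrV.

Lemma units_mulC : @commutative units units *%g.
Proof.
move=> u v; apply: val_inj.
by rewrite [LHS]units_mulE [RHS]units_mulE mulrC.
Qed.

Lemma torsion_units_subgroup : subgroup (torsion units).
Proof.
split=> [|u v [k [k_gt0 uk]] [l [l_gt0 vl]]|u [k [k_gt0 uk]]].
- by exists 1%N; rewrite expg1.
- exists (k * l)%N; rewrite muln_gt0 k_gt0 l_gt0; split=> //.
  rewrite expgMn; last exact: units_mulC.
  by rewrite expgnA uk expg1n mul1g mulnC expgnA vl expg1n.
- by exists k; split=> //; rewrite expVgn uk invg1.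
Qed.

End Units.

Section UpperTriangular.

Variables (R : comUnitRingType) (n : nat).

(* [is_trig_mx] means lower triangular, hence the transpose. *)
Definition is_upper_unit (A : 'M[R]_n) : bool :=
  is_trig_mx A^T && [forall i, A i i \is a GRing.unit].

Record upper := Upper {
  upper_val :> 'M[R]_n;
  upper_valP : is_upper_unit upper_val }.

HB.instance Definition _ := [isSub for upper_val].
HB.instance Definition _ := [Choice of upper by <:].

Lemma is_upper_unitP (A : 'M[R]_n) :
  reflect ((forall i j : 'I_n, (j < i)%N -> A i j = 0%R) /\
           (forall i, A i i \is a GRing.unit))
          (is_upper_unit A).
Proof.
apply: (iffP andP) => [[/is_trig_mxP tA /forallP uA]|[tA uA]]; split=> //.
- by move=> i j ltji; have := tA j i ltji; rewrite mxE.
- by apply/is_trig_mxP => i j ltij; rewrite mxE tA.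
- exact/forallP.
Qed.

Lemma is_upper_unit_unitmx (A : 'M[R]_n) : is_upper_unit A -> A \in unitmx.
Proof.
move=> /andP[tA /forallP uA]; rewrite unitmxE -det_tr det_trig //.
by apply: rpred_prod => i _; rewrite mxE.
Qed.

Lemma is_upper_unit1 : is_upper_unit (1%:M)%R.
Proof.
apply/is_upper_unitP; split=> [i j ltji|i]; rewrite mxE ?eqxx ?unitr1 //.
by rewrite -val_eqE /= gtn_eqF.
Qed.

Lemma upper_diagM (A B : 'M[R]_n) : is_upper_unit A -> is_upper_unit B ->
  forall i, ((A *m B) i i = A i i * B i i)%R.
Proof.
move=> /is_upper_unitP[tA _] /is_upper_unitP[tB _] i.
rewrite mxE (bigD1 i) //= big1 ?addr0 // => k neki.
case: (ltngtP k i) => [lt|lt|/val_inj eqki].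
- by rewrite tA ?mul0r.
- by rewrite tB ?mulr0.
- by rewrite eqki eqxx in neki.
Qed.

Lemma is_upper_unitM (A B : 'M[R]_n) :
  is_upper_unit A -> is_upper_unit B -> is_upper_unit (A *m B)%R.
Proof.
move=> uA uB; apply/is_upper_unitP; split=> [i j ltji|i]; last first.
  rewrite upper_diagM // unitrMl.
    by case/is_upper_unitP: uA.
  by case/is_upper_unitP: uB.
move: uA uB => /is_upper_unitP[tA _] /is_upper_unitP[tB _].
rewrite mxE big1 // => k _; case: (ltnP k i) => [ltki|leik].
  by rewrite tA ?mul0r.
by rewrite tB ?mulr0 // (leq_trans ltji).
Qed.

Lemma is_upper_unitV (A : 'M[R]_n) :
  is_upper_unit A -> is_upper_unit (invmx A).
Proof.
move=> uA; have AV := mulmxV (is_upper_unit_unitmx uA).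
have VA := mulVmx (is_upper_unit_unitmx uA).
case/is_upper_unitP: (uA) => tA dA.
have tV (i j : 'I_n) : (j < i)%N -> invmx A i j = 0%R.
  have [m] := ubnP (n - i); elim: m i => // m IHm i lemi ltji.
  have /matrixP/(_ i j) := AV; rewrite mxE (bigD1 i) //= big1 => [|k neki].
    rewrite addr0 mxE -val_eqE /= gtn_eqF // mulr0n => eq0.
    by apply: (mulrI (dA i)); rewrite mulr0.
  case: (ltngtP k i) => [lt|lt|/val_inj eqki].
  - by rewrite tA ?mul0r.
  - rewrite (IHm k) ?mulr0 //; last exact: ltn_trans ltji lt.
    by apply: leq_trans (ltn_sub2l (ltn_ord i) lt) _; rewrite -ltnS.
  - by rewrite eqki eqxx in neki.
apply/is_upper_unitP; split=> // i.
have /matrixP/(_ i i) := AV; rewrite mxE (bigD1 i) //= big1 => [|k neki].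
  rewrite addr0 mxE eqxx => eq1; apply/unitrP; exists (A i i).
  by rewrite eq1 mulrC eq1.
case: (ltngtP k i) => [lt|lt|/val_inj eqki].
- by rewrite tA ?mul0r.
- by rewrite tV ?mulr0.
- by rewrite eqki eqxx in neki.
Qed.

Definition upper_one := Upper is_upper_unit1.

Definition upper_mul (A B : upper) : upper :=
  Upper (is_upper_unitM (upper_valP A) (upper_valP B)).

Definition upper_inv (A : upper) : upper :=
  Upper (is_upper_unitV (upper_valP A)).

Lemma upper_mulA : associative upper_mul.
Proof. by move=> A B C; apply: val_inj; rewrite /= mulmxA. Qed.

Lemma upper_mul1 : left_id upper_one upper_mul.
Proof. by move=> A; apply: val_inj; rewrite /= mul1mx. Qed.

Lemma upper_mulr1 : right_id upper_one upper_mul.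
Proof. by move=> A; apply: val_inj; rewrite /= mulmx1. Qed.

Lemma upper_mulV : left_inverse upper_one upper_inv upper_mul.
Proof.
move=> A; apply: val_inj; rewrite /= mulVmx //.
exact: is_upper_unit_unitmx (upper_valP A).
Qed.

Lemma upper_mulrV : right_inverse upper_one upper_inv upper_mul.
Proof.
move=> A; apply: val_inj; rewrite /= mulmxV //.
exact: is_upper_unit_unitmx (upper_valP A).
Qed.

HB.instance Definition _ :=
  isGroup.Build upper upper_mulA upper_mul1 upper_mulr1 upper_mulV upper_mulrV.

Lemma upper_diag_unit (A : upper) (i : 'I_n) :
  upper_val A i i \is a GRing.unit.
Proof. by case/is_upper_unitP: (upper_valP A). Qed.

Definition diag_unit (A : upper) (i : 'I_n) : units R :=
  Units (upper_diag_unit A i).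

Definition UT : set upper := [set A | forall i, diag_unit A i = 1].

Definition diagonals (S : set (units R)) : set upper :=
  [set A | is_diag_mx (upper_val A) /\ forall i, S (diag_unit A i)].

(* The internal semidirect product of [UT] and [diagonals S] inside [upper];
   see [UT_sdprod_DP] for the agreement with [internal_sdprod]. *)
Definition UT_sdprod_D (S : set (units R)) : set upper :=
  [set A | forall i, S (diag_unit A i)].

Lemma diag_unitM (A B : upper) i :
  diag_unit (A * B) i = diag_unit A i * diag_unit B i.
Proof.
apply: val_inj; rewrite [RHS]units_mulE /=.
exact: upper_diagM (upper_valP A) (upper_valP B) i.
Qed.

Lemma diag_unit1 i : diag_unit 1 i = 1.
Proof. by apply: val_inj; rewrite /= mxE eqxx. Qed.

Lemma diag_unitV (A : upper) i : diag_unit A^-1 i = (diag_unit A i)^-1.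
Proof.
by apply: (mulIg (diag_unit A i)); rewrite -diag_unitM !mulVg diag_unit1.
Qed.

Lemma UT_sdprod_DP (S : set (units R)) :
  subgroup S -> internal_sdprod UT (diagonals S) (UT_sdprod_D S).
Proof.
case=> S1 SM SV.
have diagV (A : upper) : is_diag_mx (upper_val A) ->
    is_diag_mx (upper_val A^-1).
  move=> /is_diag_mxP dA; apply/is_diag_mxP => i j neij.
  have /matrixP/(_ i j) := congr1 upper_val (mulgV A).
  rewrite mxE (bigD1 i) //= big1 => [|k neki].
    rewrite addr0 mxE -val_eqE /= (negPf neij) mulr0n => eq0.
    by apply: (mulrI (upper_diag_unit A i)); rewrite mulr0.
  by rewrite dA ?mul0r // eq_sym val_eqE.
split.
- split=> [i|A B hA hB i|A hA i]; first exact: diag_unit1.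
    by rewrite diag_unitM hA hB mulg1.
  by rewrite diag_unitV hA invg1.
- split=> [|A B [dA sA] [dB sB]|A [dA sA]].
  + split=> [|i]; last by rewrite diag_unit1.
    exact: scalar_mx_is_diag.
  + split=> [|i]; last by rewrite diag_unitM; apply: SM.
    apply/is_diag_mxP => i j neij /=; rewrite mxE big1 // => k _.
    have [eqik|neik] := eqVneq i k.
      by move/is_diag_mxP: dB => -> //; rewrite ?mulr0 // -eqik.
    by move/is_diag_mxP: dA => -> //; rewrite mul0r.
  + by split=> [|i]; [exact: diagV | rewrite diag_unitV; apply: SV].
- by move=> A B hA _ i; rewrite !diag_unitM diag_unitV hA mul1g mulVg.
- apply/seteqP; split=> [A [hA [/is_diag_mxP dA _]]|A ->].
    apply: val_inj; apply/matrixP => i j /=; rewrite mxE.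
    have [<-|neij] := eqVneq i j; last by rewrite dA // mulr0n.
    by rewrite mulr1n; have := congr1 val (hA i).
  split=> [i|]; first exact: diag_unit1.
  by split=> [|i]; [exact: scalar_mx_is_diag | rewrite diag_unit1].
- apply/seteqP; split=> [A sA|_ [A hA [B [dB sB] <-]] i]; last first.
    by rewrite diag_unitM hA mul1g.
  pose d := (\matrix_(i, j) (if i == j then upper_val A i i else 0))%R
    : 'M[R]_n.
  have dd : is_diag_mx d.
    by apply/is_diag_mxP => i j neij; rewrite mxE -val_eqE (negPf neij).
  have ud : is_upper_unit d.
    apply/is_upper_unitP; split=> [i j ltji|i]; rewrite mxE.
      by rewrite -val_eqE /= gtn_eqF.
    by rewrite eqxx upper_diag_unit.
  have dE i : diag_unit (Upper ud) i = diag_unit A i.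
    by apply: val_inj; rewrite /= mxE eqxx.
  exists (A * (Upper ud)^-1).
    by move=> i; rewrite diag_unitM diag_unitV dE mulgV.
  exists (Upper ud); last by rewrite mulgVK.
  by split=> // i; rewrite dE.
Qed.

End UpperTriangular.

Arguments UT : clear implicits.
Arguments diagonals : clear implicits.
Arguments UT_sdprod_D : clear implicits.

(* Main.v *)
(** If a product of conjugates of [g] is generalized torsion, then so is [g].
    Starting from a unitriangular [A] whose first [k - 1] superdiagonals vanish,
    conjugate by the diagonal sign matrix [D] with entries [(-1)^(i / k)]: this
    changes the sign of the [k]-th superdiagonal, so the first [k] superdiagonals
    of [A * A ^ D] vanish, and after finitely many such steps the product is 1.
    A matrix with torsion diagonal has a power that is unitriangular.
    Conversely the diagonal entries are homomorphisms to the abelian group of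
    units, under which [g] and its conjugates have the same image. *)
Require Import Defs.
From mathcomp Require Import all_boot all_order all_algebra.
From mathcomp Require Import boolp classical_sets.

Set Implicit Arguments.
Unset Strict Implicit.
Unset Printing Implicit Defensive.

Import GRing.Theory.

Local Open Scope group_scope.
Local Open Scope classical_set_scope.

(** * Products of conjugates of an element *)

Section GeneralizedTorsion.

Variable G : groupType.
Implicit Types (g h y : G) (s : seq G).

(** Conjugators form a nonempty list rather than an indexed family, so that products correspond to
    concatenation. *)
Definition conj_product g h : Prop :=
  exists2 s, (0 < size s)%N & \prod_(x <- s) g ^ x = h.

Lemma generalized_torsionP g :
  generalized_torsion G g <-> conj_product g 1.
Proof.
split=> [[k [x [k_gt0 eq1]]]|[s s_gt0 eq1]].
  exists [seq x i | i <- index_enum 'I_k]; last by rewrite big_map.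
  rewrite size_map; apply: leq_trans (_ : size [:: Ordinal k_gt0] <= _)%N => //.
  by apply: uniq_leq_size => // i _; apply: mem_index_enum.
exists (size s), (tnth (in_tuple s)); split=> //.
by rewrite -(big_tnth _ _ s xpredT (fun x => g ^ x)).
Qed.

Lemma conj_productJ g y : conj_product g (g ^ y).
Proof. by exists [:: y]; rewrite // big_seq1. Qed.

Lemma conj_productM g h1 h2 :
  conj_product g h1 -> conj_product g h2 -> conj_product g (h1 * h2).
Proof.
move=> [s1 s1_gt0 <-] [s2 _ <-]; exists (s1 ++ s2); last by rewrite big_cat.
by rewrite size_cat addn_gt0 s1_gt0.
Qed.

Lemma conj_product_conjg g h y : conj_product g h -> conj_product g (h ^ y).
Proof.
move=> [s s_gt0 <-]; exists [seq x * y | x <- s]; first by rewrite size_map.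
rewrite big_map; elim: s {s_gt0} => [|x s IHs]; first by rewrite !big_nil conj1g.
by rewrite !big_cons conjMg -IHs conjgM.
Qed.

(** Conjugates of [h] are again products of conjugates of [g], and such products are closed under
    multiplication. *)
Lemma conj_product_trans g h y :
  conj_product g h -> conj_product h y -> conj_product g y.
Proof.
move=> gh [[//|x s] _ <-]; elim: s x => [|z s IHs] x.
  by rewrite big_seq1; apply: conj_product_conjg.
by rewrite big_cons; apply: conj_productM (IHs z); apply: conj_product_conjg.
Qed.

Lemma conj_productX g k : (0 < k)%N -> conj_product g (g ^+ k).
Proof.
have gg : conj_product g g by rewrite -{2}[g]conjg1; apply: conj_productJ.
case: k => // k _; elim: k => [|k IHk]; first by rewrite expg1.
by rewrite expgS; apply: conj_productM.
Qed.

Lemma generalized_torsion_conj_product g h :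
  conj_product g h -> generalized_torsion G h -> generalized_torsion G g.
Proof.
move=> gh /generalized_torsionP h1; apply/generalized_torsionP.
exact: conj_product_trans gh h1.
Qed.

End GeneralizedTorsion.

(** * Behaviour under homomorphisms and automorphisms *)

Section Morphism.

Variables (G H : groupType) (phi : {multiplicative G -> H}).

Lemma multiplicative1 : phi 1 = 1.
Proof. by apply: (mulgI (phi 1)); rewrite -gmulfM !mulg1. Qed.

Lemma multiplicativeV : {morph phi : x / x^-1}.
Proof.
by move=> x; apply: (mulgI (phi x)); rewrite -gmulfM !mulgV multiplicative1.
Qed.

Lemma multiplicativeJ : {morph phi : x y / x ^ y}.
Proof. by move=> x y; rewrite !conjgE !gmulfM multiplicativeV. Qed.

Lemma multiplicative_prod (I : Type) (r : seq I) (F : I -> G) :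
  phi (\prod_(i <- r) F i) = \prod_(i <- r) phi (F i).
Proof. exact: (big_morph phi gmulfM multiplicative1). Qed.

Lemma generalized_torsion_morph (g : G) :
  generalized_torsion G g -> generalized_torsion H (phi g).
Proof.
move=> [k [x [k_gt0 eq1]]]; exists k, (phi \o x); split=> //.
rewrite -[RHS]multiplicative1 -eq1 multiplicative_prod.
by apply: eq_bigr => i _; rewrite multiplicativeJ.
Qed.

End Morphism.

Lemma generalized_torsion_automorphism (G : groupType)
    (phi : {multiplicative G -> G}) :
  bijective phi -> phi @` generalized_torsion G = generalized_torsion G.
Proof.
move=> [psi phiK psiK]; apply/seteqP; split=> [_ [g tg <-]|g tg].
  exact: generalized_torsion_morph.
exists (psi g); last exact: psiK.
move: tg => [k [x [k_gt0 eq1]]]; exists k, (psi \o x); split=> //.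
(* [psi] is only a set-theoretic inverse, so the identity is checked after applying the injective
   morphism [phi]. *)
apply: (can_inj phiK); rewrite multiplicative1 multiplicative_prod -[RHS]eq1.
by apply: eq_bigr => i _; rewrite multiplicativeJ /= !psiK.
Qed.

(** * Generalized torsion in the upper triangular group *)

Section UpperTriangular.

Variables (R : comUnitRingType) (n : nat).
Implicit Types A B : upper R n.

Lemma diag_unitJ A B i : diag_unit (A ^ B) i = diag_unit A i.
Proof.
by rewrite conjgE !diag_unitM diag_unitV [X in _ * X]units_mulC mulKg.
Qed.

Lemma diag_unit_prod (I : Type) (r : seq I) (F : I -> upper R n) i :
  diag_unit (\prod_(l <- r) F l) i = \prod_(l <- r) diag_unit (F l) i.
Proof.
elim: r => [|l r IHr]; first by rewrite !big_nil diag_unit1.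
by rewrite !big_cons diag_unitM IHr.
Qed.

Lemma diag_unitX A k i : diag_unit (A ^+ k) i = diag_unit A i ^+ k.
Proof.
by elim: k => [|k IHk]; rewrite ?expg0 ?diag_unit1 // !expgS diag_unitM IHk.
Qed.

Lemma upper_eq0 A (i j : 'I_n) : (j < i)%N -> upper_val A i j = 0%R.
Proof. by case/is_upper_unitP: (upper_valP A) => tA _; apply: tA. Qed.

(** The sign is constant on blocks of [k] consecutive indices and alternates from block to block, so
    indices at distance [k] carry opposite signs. *)
Definition sign_mx (k : nat) : 'M[R]_n :=
  (\matrix_(i, j) if i == j then (-1) ^+ (i %/ k) else 0)%R.

Lemma sign_mx_upper k : is_upper_unit (sign_mx k).
Proof.
apply/is_upper_unitP; split=> [i j ltji|i]; rewrite mxE.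
  by rewrite -val_eqE /= gtn_eqF.
by rewrite eqxx unitrX // unitrN1.
Qed.

Definition sign_upper k : upper R n := Upper (sign_mx_upper k).

Lemma conjg_signE A k (i j : 'I_n) :
  upper_val (A ^ sign_upper k) i j
    = ((-1) ^+ (i %/ k) * (-1) ^+ (j %/ k) * upper_val A i j)%R.
Proof.
(* Comparing entries in [A * D = D * A ^ D] avoids computing the inverse of the sign matrix [D]. *)
have /matrixP/(_ i j) := congr1 (@upper_val R n) (conjgC A (sign_upper k)).
rewrite [LHS]mxE [RHS]mxE (bigD1 j) //= big1 => [|l nelj]; last first.
  by rewrite mxE (negPf nelj) mulr0.
rewrite (bigD1 i) //= big1 => [|l neli]; last first.
  by rewrite mxE eq_sym (negPf neli) mul0r.
rewrite !addr0 !mxE !eqxx => eqAB.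
by rewrite -mulrA (mulrC _ (upper_val A i j)) eqAB mulrA -expr2 sqrr_sign mul1r.
Qed.

(** The bound is strict: only the superdiagonals 1 to [k - 1] are concerned, so [k = 1] imposes
    nothing. *)
Definition superdiag_vanish (k : nat) A : Prop :=
  forall i j : 'I_n, (i < j)%N -> (j < i + k)%N -> upper_val A i j = 0%R.

Lemma superdiag_vanishS k A : (0 < k)%N -> UT R n A ->
  superdiag_vanish k A -> superdiag_vanish k.+1 (A * A ^ sign_upper k).
Proof.
move=> k_gt0 utA vA i j ltij; rewrite addnS ltnS => lejk.
have A1 l : upper_val A l l = 1%R := congr1 val (utA l).
have neij : i != j by rewrite -val_eqE /= ltn_eqF.
(* Only the terms at [i] and [j] survive; as the diagonals are 1, they add up to the [(i, j)]
   entries of [A ^ D] and [A]. *)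
rewrite [LHS]mxE (bigD1 i) //= (bigD1 j) 1?eq_sym //= big1 => [|l].
  rewrite addr0 !conjg_signE !A1 mulr1 mul1r -expr2 sqrr_sign mulr1.
  case: (ltngtP (j : nat) (i + k)) lejk => // [ltjk|->] _.
    by rewrite vA // mulr0 addr0.
  (* For [j = i + k] the quotient by [k] grows by exactly one, so the two entries are opposite and
     cancel. *)
  rewrite -{2}(mul1n k) addnC divnMDl // add1n exprS mulN1r mulrN -expr2.
  by rewrite sqrr_sign mulN1r addNr.
move=> /andP[neli nelj]; case: (ltngtP l i) => [lt|gt|/val_inj eqli].
- by rewrite upper_eq0 ?mul0r.
- case: (ltngtP l j) => [lt|lt|/val_inj eqlj].
  + by rewrite vA ?mul0r // (leq_trans lt).
  + by rewrite (upper_eq0 (A ^ sign_upper k) lt) mulr0.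
  + by rewrite eqlj eqxx in nelj.
- by rewrite eqli eqxx in neli.
Qed.

Lemma superdiag_vanish_eq1 A : UT R n A -> superdiag_vanish n A -> A = 1.
Proof.
move=> utA vA; apply: val_inj; apply/matrixP => i j /=; rewrite mxE.
case: (ltngtP i j) => [lt|lt|/val_inj ->].
- by rewrite vA ?ltn_addl // -val_eqE /= ltn_eqF.
- by rewrite upper_eq0 // -val_eqE /= gtn_eqF.
- by rewrite eqxx; exact: (congr1 val (utA j)).
Qed.

Lemma UT_generalized_torsion : UT R n `<=` generalized_torsion (upper R n).
Proof.
move=> A utA; have {utA} : exists2 k, (0 < k)%N &
    UT R n A /\ superdiag_vanish k A.
  exists 1%N => //; split=> // i j ltij.
  by rewrite addn1 ltnS leqNgt ltij.
(* Induction on [n - k], the number of steps before every superdiagonal vanishes. *)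
move=> [k k_gt0]; have [m] := ubnP (n - k).
elim: m k k_gt0 A => // m IHm k k_gt0 A lenk [utA vA].
have [lenk'|ltkn] := leqP n k.
  have -> : A = 1.
    apply: superdiag_vanish_eq1 => // i j ltij ltj.
    by apply: vA => //; apply: leq_trans ltj _; rewrite leq_add2l.
  by apply/generalized_torsionP; rewrite -{2}(conj1g 1); apply: conj_productJ.
apply: (@generalized_torsion_conj_product _ _ (A * A ^ sign_upper k)).
  apply: conj_productM (conj_productJ _ _).
  by rewrite -{2}[A]conjg1; apply: conj_productJ.
apply: (IHm k.+1) => //.
  by rewrite -ltnS (leq_trans _ lenk) // ltnS ltn_sub2l.
split; last exact: superdiag_vanishS.
by move=> i; rewrite diag_unitM diag_unitJ utA mulg1.
Qed.

Lemma generalized_torsion_upper :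
  generalized_torsion (upper R n) = UT_sdprod_D R n (torsion (units R)).
Proof.
apply/seteqP; split=> [A [k [x [k_gt0 eq1]]] i|A tA].
  exists k; split=> //; move: (congr1 (fun B => diag_unit B i) eq1).
  (* Conjugation fixes diagonal entries, so the product of [k] conjugates has the [k]-th power of
     that of [A] as its [i]-th entry. *)
  rewrite diag_unit1 diag_unit_prod => <-.
  under eq_bigr do rewrite diag_unitJ.
  by rewrite prodg_const card_ord.
(* Pick an exponent [e i] killing each diagonal entry; the product of all of them kills the whole
   diagonal. *)
have [e he] := choice tA.
apply: (@generalized_torsion_conj_product _ _ (A ^+ (\prod_i e i)%N)).
  by apply: conj_productX; rewrite prodn_gt0 // => i; case: (he i).
apply: UT_generalized_torsion => i; rewrite diag_unitX (bigD1 i) //=.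
by rewrite expgnA (he i).2 expg1n.
Qed.

Lemma UT_sdprod_D_subgroup (S : set (units R)) :
  subgroup S -> subgroup (UT_sdprod_D R n S).
Proof.
move=> [S1 SM SV]; split=> [i|A B SA SB i|A SA i].
- by rewrite diag_unit1.
- by rewrite diag_unitM; apply: SM.
- by rewrite diag_unitV; apply: SV.
Qed.

End UpperTriangular.

Lemma UT_sdprod_D_torsion_setT (R : comUnitRingType) (n : nat) : (0 < n)%N ->
  UT_sdprod_D R n (torsion (units R)) = [set: upper R n] <->
  torsion_group (units R).
Proof.
move=> n_gt0; split=> [eqT u|tR]; last first.
  by apply/seteqP; split=> // A _ i; apply: tR.
(* The scalar matrix of [u] tests whether [u] is torsion; [n_gt0] supplies a diagonal position to
   read it off. *)
have uU : is_upper_unit ((val u)%:M : 'M_n)%R.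
  apply/is_upper_unitP; split=> [i j ltji|i]; rewrite mxE.
    by rewrite -val_eqE /= gtn_eqF.
  by rewrite eqxx (valP u).
have /(_ (Ordinal n_gt0)) : UT_sdprod_D R n (torsion (units R)) (Upper uU).
  by rewrite eqT.
congr (torsion _ _).
by apply: val_inj; rewrite /= mxE eqxx.
Qed.

Theorem theoremA (R : comUnitRingType) (n : nat) (hn : (1 <= n)%N) :
  generalized_torsion (upper R n) = UT_sdprod_D R n (torsion (units R)) /\
  characteristic_subgroup (generalized_torsion (upper R n)) /\
  UT R n `<=` generalized_torsion (upper R n) /\
  (generalized_torsion (upper R n) = [set: upper R n] <->
   torsion_group (units R)).
Proof.
split; first exact: generalized_torsion_upper.
split; last first.
  split; first exact: UT_generalized_torsion.
  by rewrite generalized_torsion_upper; apply: UT_sdprod_D_torsion_setT.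
split; last exact: generalized_torsion_automorphism.
rewrite generalized_torsion_upper.
exact/UT_sdprod_D_subgroup/torsion_units_subgroup.
Qed.
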